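(* Let $p\in[1,\infty]$ and let $H$ be a periodic discrete Schrödinger operator on $\ell^p(\mathbb{Z})$, i.e. $(Hx)_k=x_{k-1}+x_{k+1}+v(k)x_k$ for $k\in\mathbb{Z}$, where the potential $v$ on $\mathbb{Z}$ is periodic. Then the following hold. (a) If $v$ is integer-valued, then $H$ is FSM-simple. (b) If the period of $v$ is less than nine and $v$ only takes values in $\{0,\lambda\}$ with a fixed rational $\lambda$, then $H$ is FSM-simple. (c) If the period of $v$ is two and $v$ is real-valued, then $H$ is FSM-simple. Moreover, let $H_+$ be a periodic discrete Schrödinger operator on $\ell^p(\mathbb{Z}_+)$, i.e. $(H_+x)_k=x_{k-1}+x_{k+1}+v(k)x_k$ for $k\in\mathbb{Z}_+$, with the convention $x_{-1}=0$, where $v$ is periodic. Then statements (a), (b) and (c) hold with $H_+$ in place of $H$.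
   Context: $\mathbb{Z}_+=\{0,1,2,\dots\}$; $\ell^p$ spaces consist of complex sequences. The potential $v$ is $K$-periodic ($K\in\mathbb{N}$, $K\ge1$) if $v(k+K)=v(k)$ for all $k$; it is periodic if it is $K$-periodic for some such $K$. Operators are identified with their infinite matrices $(H_{ij})$ with respect to the canonical unit vectors. Finite section method (FSM): for $H$ on $\ell^p(\mathbb{Z})$ the $n$-th finite section is $H_n=(H_{ij})_{i,j=-n}^{n}$; for $H_+$ on $\ell^p(\mathbb{Z}_+)$ it is $H_n=(H_{ij})_{i,j=0}^{n}$. Each $H_n$ is regarded as an operator on the finite-dimensional space with the $\ell^p$-norm. The FSM is called applicable to $H$ (resp. $H_+$) if, for all sufficiently large $n$, the inverses $H_n^{-1}$ exist and (after embedding into an infinite matrix) approximate the inverse of the operator. This is used in the following equivalent form: the FSM is applicable if and only if (i) the operator is invertible on its $\ell^p$ space (as a bounded operator), (ii) all but finitely many $H_n$ are invertible, and (iii) their inverses are uniformly bounded, i.e. $\sup_{n\ge n_0}\|H_n^{-1}\|<\infty$ for some $n_0$. An operator is called FSM-simple if either the FSM is applicable to it or it is not invertible; that is, invertibility of the operator implies applicability of the FSM. *)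

(* Defs.v *)
From HB Require Import structures.
From mathcomp Require Import all_boot all_order all_algebra.
From mathcomp Require Import all_classical all_reals all_analysis.
From mathcomp Require Export complex.
Set Implicit Arguments.
Unset Strict Implicit.
Unset Printing Implicit Defensive.
Import Order.TTheory GRing.Theory Num.Theory.
Local Open Scope classical_set_scope.
Local Open Scope ring_scope.

Section Lp.
Context {R : realType}.
Local Notation C := R[i].

(* The index type [I] is [int], [nat], or ['I_m] (finite-dimensional case).
   [normc] is the modulus with values in [R] instead of [R[i]].  Only
   [1 <= p] is meaningful; the value at [-oo] is a dummy. *)
Definition lpnorm (I : choiceType) (p : \bar R) (x : I -> C) : \bar R :=
  match p with
  | r%:E => ((\esum_(i in [set: I]) (Normc.normc (x i) `^ r)%:E) `^ r^-1)%E
  | +oo%E => ereal_sup (range (fun i => (Normc.normc (x i))%:E))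
  | -oo%E => 0%E
  end.

Definition lp (I : choiceType) (p : \bar R) : set (I -> C) :=
  [set x | (lpnorm p x < +oo)%E].

Definition opnorm (I : choiceType) (p : \bar R) (A : (I -> C) -> (I -> C)) :
    \bar R :=
  ereal_sup [set lpnorm p (A x) | x in [set x | (lpnorm p x <= 1)%E]].

(* An operator on l^p is represented by a function on all sequences, of which
   only the restriction to l^p matters. *)
Definition bounded_operator (I : choiceType) (p : \bar R)
    (A : (I -> C) -> (I -> C)) : Prop :=
  [/\ forall x, lp p x -> lp p (A x),
      forall (a : C) x y, lp p x -> lp p y -> A (a *: x + y) = a *: A x + A y
    & (opnorm p A < +oo)%E].

Definition invertible_operator (I : choiceType) (p : \bar R)
    (A : (I -> C) -> (I -> C)) : Prop :=
  bounded_operator p A /\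
  exists B : (I -> C) -> (I -> C),
    bounded_operator p B /\ (forall x, lp p x -> B (A x) = x /\ A (B x) = x).

Definition unit_vector (I : choiceType) (j : I) : I -> C :=
  fun i => (i == j)%:R.

Definition entry (I : choiceType) (A : (I -> C) -> (I -> C)) (i j : I) : C :=
  A (unit_vector j) i.

Definition finite_sectionZ (A : (int -> C) -> (int -> C)) (n : nat) :
    'M[C]_(n.*2.+1) :=
  \matrix_(i, j) entry A (i%:Z - n%:Z) (j%:Z - n%:Z).

Definition finite_sectionN (A : (nat -> C) -> (nat -> C)) (n : nat) :
    'M[C]_n.+1 :=
  \matrix_(i, j) entry A i j.

Definition mx_operator (m : nat) (M : 'M[C]_m) (x : 'I_m -> C) : 'I_m -> C :=
  fun i => \sum_(j < m) M i j * x j.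

(* [S n] is the n-th finite section of [A]. *)
Definition FSM_applicable (I : choiceType) (p : \bar R)
    (A : (I -> C) -> (I -> C)) (d : nat -> nat) (S : forall n, 'M[C]_(d n)) :
    Prop :=
  invertible_operator p A /\
  exists n0 : nat,
    (forall n, (n0 <= n)%N -> S n \in unitmx) /\
    (ereal_sup [set opnorm p (mx_operator (invmx (S n))) |
                  n in [set n | (n0 <= n)%N]] < +oo)%E.

Definition FSM_simple (I : choiceType) (p : \bar R)
    (A : (I -> C) -> (I -> C)) (d : nat -> nat) (S : forall n, 'M[C]_(d n)) :
    Prop :=
  FSM_applicable p A S \/ ~ invertible_operator p A.

Definition FSM_simpleZ (p : \bar R) (A : (int -> C) -> (int -> C)) : Prop :=
  FSM_simple p A (finite_sectionZ A).

Definition FSM_simpleN (p : \bar R) (A : (nat -> C) -> (nat -> C)) : Prop :=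
  FSM_simple p A (finite_sectionN A).

Definition schrodingerZ (v : int -> C) (x : int -> C) : int -> C :=
  fun k => x (k - 1) + x (k + 1) + v k * x k.

Definition schrodingerN (v : nat -> C) (x : nat -> C) : nat -> C :=
  fun k => (if k is k'.+1 then x k' else 0) + x k.+1 + v k * x k.

(* [K] need not be the minimal period. *)
Definition K_periodicZ (K : nat) (v : int -> C) : Prop :=
  (0 < K)%N /\ forall k, v (k + K%:Z) = v k.

Definition K_periodicN (K : nat) (v : nat -> C) : Prop :=
  (0 < K)%N /\ forall k, v (k + K)%N = v k.

Definition integer_valued (I : Type) (v : I -> C) : Prop :=
  forall k, exists m : int, v k = m%:~R.

Definition real_valued (I : Type) (v : I -> C) : Prop :=
  forall k, v k \is Num.real.

End Lp.

Lemma lpnorm_Lnorm (R : realType) (r : R) (x : nat -> R[i]) : 0 < r ->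
  lpnorm r%:E x = Lnorm counting r%:E (fun k => (Normc.normc (x k))%:E).
Proof.
move=> r0; rewrite Lnorm_counting// nneseries_esumT; last first.
  by move=> ?; rewrite lee_fin powR_ge0.
congr (_ `^ _)%E; apply: eq_esum => k _ /=.
by rewrite ger0_norm//; case: (x k) => a b; rewrite /Normc.normc sqrtr_ge0.
Qed.

(* Main.v *)
Require Import Defs.
From Stdlib Require BinInt.
From mathcomp Require Import all_boot all_order all_algebra.
From mathcomp Require Import all_classical all_reals all_analysis.
From mathcomp Require Import ssrZ ring lra zify.
Import Order.TTheory GRing.Theory Num.Theory.
Import Normc.
Set Implicit Arguments.
Unset Strict Implicit.
Unset Printing Implicit Defensive.
Local Open Scope ring_scope.

(** Write [S_a n] for [dirichlet v a n], the solution of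
    [q (n + 2) = v (a + n) * q (n + 1) - q n] with [S_a 0 = 0] and [S_a 1 = 1].
    Up to alternating signs this is the solution of [H x = 0] that vanishes at
    the site [a - 1], and [S_a (n + 1)] is the determinant of the section of
    [H] on the sites [a, ..., a + n - 1].  For a [K]-periodic potential the
    recursion over one period is a [2 x 2] matrix of determinant one, whose
    trace, the discriminant, does not depend on [a].  Let [lam] and [1 / lam]
    be its eigenvalues, [1 <= |lam|].

    If [|lam| = 1], some nonzero solution satisfies [|q (n + K)| = |q n|]
    ([bounded_solution]).  Multiplied by a tent of slope one over [4 l] sites, it
    becomes a vector [x] such that [H x] is bounded independently of [l] and
    carried by these sites, while [|x|] is at least a constant times [l] on a
    fixed proportion of them ([tapered_floquet]).  In every [l^p] the ratio of
    the norms tends to infinity, so [H] is not invertible ([not_invertible]).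

    If [|lam| > 1], the finite sections are inverted explicitly: an entry of
    the inverse is, up to sign, a product of two determinants of smaller
    sections over the determinant of the whole ([jacobi_green]).  If
    [|S_a n|] is comparable with [|lam| ^ (n / K)] from above and below,
    uniformly in [a], these entries decay exponentially away from the
    diagonal, and Schur's test bounds the inverses on every [l^p]
    ([jacobi_stability]).  The upper estimate always holds.  The lower one
    ([growth]) can fail only if the Dirichlet initial vector is an eigenvector
    of the period matrix started at some site, that is, if [S_a K = 0]; the
    eigenvalue is then [S_a (K + 1)], whose modulus is not one.  Hence both
    operators are FSM-simple whenever [S_a K = 0] forces
    [S_a (K + 1) ^ 2 = 1] ([FSM_simpleZ_periodic], [FSM_simpleN_periodic]).

    This last condition is arithmetic.  If [S_a K = 0], determinant one says
    that [S_a (K + 1)] is invertible in the ring generated by the potential,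
    so it is 1 or -1 for an integer potential.  For period two it equals -1.
    For the values 0 and [lambda], [S_a K] is a polynomial in [lambda] with
    integer coefficients that depends only on a word of at most seven letters;
    the rational root theorem leaves finitely many candidates for [lambda],
    and all of them are tested by computation ([short_word_root]). *)

(** * Dirichlet solutions of the three-term recursion *)

Section Continuant.
Context {F : comNzRingType}.
Implicit Types (v q : nat -> F) (a n i : nat).

(** The signs of the Dirichlet solution of [H x = 0] are removed: [x] solves
    [x (j - 1) + x (j + 1) + v j * x j = 0] exactly when
    [q (j + 1) = (-1) ^ j * x j] solves the recursion below, which also makes
    [dirichlet v a n.+1] the determinant of the section on [a, ..., a + n - 1]. *)
Fixpoint dirichlet v a n : F :=
  match n with
  | 0 => 0
  | n'.+1 => if n' is n''.+1 then v (a + n'')%N * dirichlet v a n' - dirichlet v a n''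
             else 1
  end.

Lemma dirichletSS v a n :
  dirichlet v a n.+2 = v (a + n)%N * dirichlet v a n.+1 - dirichlet v a n.
Proof. by []. Qed.

Definition solution v a q :=
  forall n, q n.+2 = v (a + n)%N * q n.+1 - q n.

Lemma solution_dirichlet v a : solution v a (dirichlet v a).
Proof. by move=> n; rewrite dirichletSS. Qed.

Lemma solution_shift v a q i :
  solution v a q -> solution v (a + i) (fun n => q (n + i)%N).
Proof. by move=> sq n /=; rewrite !addSn sq -addnA [(i + n)%N]addnC. Qed.

(** Any solution is the combination of the two Dirichlet solutions based at
    [a] and [a + 1] that matches its first two values. *)
Lemma solutionE v a q : solution v a q ->
  forall n, q n.+1 = q 1%N * dirichlet v a n.+1 - q 0%N * dirichlet v a.+1 n.
Proof.
move=> sq n; suff [] : q n.+1 = q 1%N * dirichlet v a n.+1 - q 0%N * dirichlet v a.+1 n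
   /\ q n.+2 = q 1%N * dirichlet v a n.+2 - q 0%N * dirichlet v a.+1 n.+1 by [].
elim: n => [|n [IH1 IH2]].
  by rewrite sq /= !addn0; split; ring.
split=> //; rewrite sq IH1 IH2 (dirichletSS v a n.+1) (dirichletSS v a.+1 n).
rewrite addnS addSn; ring.
Qed.

(** The determinant of a tridiagonal matrix can be expanded along its first
    row as well as along its last one. *)
Lemma dirichlet_lrec v a n :
  dirichlet v a n.+2 = v a * dirichlet v a.+1 n.+1 - dirichlet v a.+2 n.
Proof.
suff [] : dirichlet v a n.+2 = v a * dirichlet v a.+1 n.+1 - dirichlet v a.+2 n /\
  dirichlet v a n.+3 = v a * dirichlet v a.+1 n.+2 - dirichlet v a.+2 n.+1 by [].
elim: n => [|n [IH1 IH2]]; first by rewrite /= addn1 !addn0; split; ring.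
split=> //; rewrite (dirichletSS v a n.+2) IH2 IH1.
rewrite (dirichletSS v a.+1 n.+1) (dirichletSS v a.+2 n).
rewrite !addSn !addnS; ring.
Qed.

(** The transfer matrices over two adjacent blocks multiply to the one over
    their union; this is the upper left entry of that product. *)
Lemma dirichlet_add v a i n :
  dirichlet v a i.+1 * dirichlet v (a + i) n.+1
  - dirichlet v a i * dirichlet v (a + i).+1 n
  = dirichlet v a (i + n).+1.
Proof.
elim: i n => [|i IH] n.
  by rewrite addn0 add0n [dirichlet v a 1]/= [dirichlet v a 0]/=; ring.
rewrite addSnnS -(IH n.+1) (dirichletSS v a i) (dirichlet_lrec v (a + i) n) addnS; ring.
Qed.

(** Each one-step transfer matrix has determinant one, hence so has their
    product. *)
Lemma dirichlet_wronskian v a n :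
  dirichlet v a n.+2 * dirichlet v a.+1 n
  - dirichlet v a n.+1 * dirichlet v a.+1 n.+1 = -1.
Proof.
elim: n => [|n IH]; first by rewrite /=; ring.
rewrite -[RHS]IH (dirichletSS v a n.+1) (dirichletSS v a.+1 n) addSn addnS; ring.
Qed.

Lemma dirichlet_eq v w a b n : (forall i, (i + 1 < n)%N -> v (a + i)%N = w (b + i)%N) ->
  dirichlet v a n = dirichlet w b n.
Proof.
move=> vw; suff H : forall m, (m <= n)%N -> dirichlet v a m = dirichlet w b m by exact: H.
apply: ltn_ind => -[|[|m]] // IH mn.
rewrite !dirichletSS vw; last lia.
by rewrite !IH //; lia.
Qed.

(** * Periodic potentials: the discriminant and Floquet solutions *)

Section Periodic.
Opaque dirichlet.
Variables (v : nat -> F) (k : nat).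
Let K := k.+1.
Hypothesis vK : forall j, v (j + K)%N = v j.

Lemma periodic_mul j m : v (j + m * K)%N = v j.
Proof. by elim: m => [|m IH]; rewrite ?addn0 // mulSn addnCA addnC vK. Qed.

Lemma dirichlet_mod a n : dirichlet v a n = dirichlet v (a %% K)%N n.
Proof.
apply: dirichlet_eq => i _; rewrite -[RHS](periodic_mul _ (a %/ K)); congr (v _).
by rewrite addnAC [(a %% K + _)%N]addnC -divn_eq.
Qed.

(** The trace of the transfer matrix from the sites [a - 1, a] to the sites
    one period later. *)
Definition discriminant a := dirichlet v a K.+1 - dirichlet v a.+1 k.

(** The period matrices at [a] and [a + 1] are conjugate; here the two
    expansions of the determinant show directly that the traces agree. *)
Lemma discriminantS a : discriminant a.+1 = discriminant a.
Proof.
rewrite /discriminant /K (dirichlet_lrec v a) (dirichletSS v a.+1) addSnnS vK; ring.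
Qed.

Lemma discriminant_const a : discriminant a = discriminant 0.
Proof. by elim: a => // a IH; rewrite discriminantS. Qed.

Lemma solution_shiftK a q : solution v a q -> solution v a (fun n => q (n + K)%N).
Proof.
move=> sq n /=; rewrite (solution_shift K sq n) /=.
by rewrite addnAC vK.
Qed.

(** Cayley-Hamilton for the period matrix, read along one solution. *)
Lemma cayley_hamilton a q : solution v a q -> forall n,
  q (n + K + K)%N - discriminant 0 * q (n + K)%N + q n = 0.
Proof.
move=> sq n; rewrite -(discriminant_const (a + n)).
have {}sq := solution_shift n sq; move: (a + n)%N sq => {}a sq.
suff: q (K + K + n)%N - discriminant a * q (K + n)%N + q n = 0.
  by rewrite ![(_ + n)%N]addnC !addnA.
set q' := (fun j => q (j + n)%N) in sq.
rewrite -[q (K + K + n)%N]/(q' (K + K)%N) -[q (K + n)%N]/(q' K) -[q n]/(q' 0%N).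
have E2 := solutionE (solution_shiftK sq) k; cbn beta in E2.
rewrite -[k.+1]/K add0n add1n in E2; rewrite E2.
rewrite [q' K.+1](solutionE sq) [q' K](solutionE sq) /discriminant.
transitivity (q' 0%N * (dirichlet v a K.+1 * dirichlet v a.+1 k
                        - dirichlet v a K * dirichlet v a.+1 K + 1)).
  by rewrite /K; ring.
by rewrite /K dirichlet_wronskian addNr mulr0.
Qed.

(** If [x] and [y] are the two multipliers, subtracting [y * q] from the
    shifted solution kills the [y]-component of [q] and leaves a Floquet
    solution with multiplier [x]. *)
Definition floquet_part q (y : F) n := q (n + K)%N - y * q n.

Lemma solution_floquet a q y : solution v a q -> solution v a (floquet_part q y).
Proof.
move=> sq n; rewrite /floquet_part (solution_shiftK sq) sq; ring.
Qed.

Lemma floquet_partM a q x y : solution v a q ->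
  x + y = discriminant 0 -> x * y = 1 ->
  forall n m, floquet_part q y (n + m * K) = x ^+ m * floquet_part q y n.
Proof.
move=> sq xy xy1 n m.
have wK j : floquet_part q y (j + K) = x * floquet_part q y j.
  have := cayley_hamilton sq j; rewrite -xy /floquet_part.
  move: (q (j + K + K)%N) (q (j + K)%N) (q j) => q2 q1 q0 CH.
  rewrite mulrBr mulrA xy1 mul1r -[LHS]subr0 -CH; ring.
elim: m => [|m IH]; first by rewrite addn0 expr0 mul1r.
by rewrite mulSn addnCA addnC wK IH exprS mulrA.
Qed.
End Periodic.
End Continuant.

(** * Exponential growth for a multiplier off the unit circle *)

Section NormC.
Context {R : realType}.
Local Notation C := R[i].
Implicit Types x y : C.

Lemma normc_ge0 x : 0 <= normc x.
Proof. by case: x => a b; rewrite sqrtr_ge0. Qed.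

Lemma normc_eq0 x : (normc x == 0) = (x == 0).
Proof.
apply/eqP/eqP => [/eq0_normc//|->]; exact: normc0.
Qed.

Lemma normc_gt0 x : (0 < normc x) = (x != 0).
Proof. by rewrite lt0r normc_ge0 andbT normc_eq0. Qed.

Lemma normcX x n : normc (x ^+ n) = normc x ^+ n.
Proof. by elim: n => [|n IH]; rewrite ?normc1 // !exprS normcM IH. Qed.

Lemma normc_sub x y : normc x - normc y <= normc (x - y).
Proof. by rewrite lerBlDr -{1}(subrK y x) le_normcD. Qed.

Lemma normc_subD x y : normc (x - y) <= normc x + normc y.
Proof. by rewrite -(normcN y) le_normcD. Qed.

Lemma nat_ge (x : R) : exists N, forall n, (N <= n)%N -> x <= n%:R.
Proof.
exists (Num.truncn x).+1 => n Nn.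
by apply: le_trans (ltW (real_truncnS_gt (num_real x))) _; rewrite ler_nat.
Qed.

(** Bernoulli's inequality bounds [L ^+ m] below by [1 + m * (L - 1)]. *)
Lemma exprn_unbounded (L x : R) : 1 < L -> exists N, forall m, (N <= m)%N -> x <= L ^+ m.
Proof.
move=> L1; have bern m : 1 + m%:R * (L - 1) <= L ^+ m.
  elim: m => [|m IH]; first by rewrite mul0r addr0 expr0.
  rewrite exprS; have m0 : 0 <= m%:R :> R by [].
  have : L * (1 + m%:R * (L - 1)) <= L * L ^+ m by rewrite ler_wpM2l //; lra.
  apply: le_trans; rewrite -subr_ge0 -natr1.
  suff -> : L * (1 + m%:R * (L - 1)) - (1 + (m%:R + 1) * (L - 1))
    = m%:R * (L - 1) ^+ 2 by rewrite mulr_ge0 ?sqr_ge0.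
  ring.
have [N HN] := nat_ge (x / (L - 1)); exists N => m /HN.
by rewrite ler_pdivrMr ?subr_gt0// => xm; apply: le_trans (bern m); lra.
Qed.
End NormC.

Section Growth.
Context {R : realType}.
Local Notation C := R[i].
Variables (v : nat -> C) (k : nat).
Local Notation K := k.+1.
Hypothesis vK : forall j, v (j + K)%N = v j.
Variable lam : C.
Hypothesis lamE : lam + lam^-1 = discriminant v k 0.
Hypothesis lam1 : 1 < normc lam.
Hypothesis dirichletK : forall a, dirichlet v a K != 0.

Lemma lam_neq0 : lam != 0.
Proof. by rewrite -normc_gt0; apply: lt_trans lam1. Qed.

Lemma lam_sub_neq0 : lam - lam^-1 != 0.
Proof.
rewrite subr_eq0; apply/eqP => /(congr1 (@normc R)); rewrite normcV => E.
by have := invf_lt1 (lt_trans ltr01 lam1); rewrite -E lam1 ltNge ltW.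
Qed.

(** The coefficient of the growing term of [n |-> dirichlet v a n] along the
    residue class of [r].  If it vanished at [r], the growing Floquet solution
    [w] of base [a] would vanish at [r] and be a multiple of the Dirichlet
    solution of base [a + r]; as [w] vanishes again one period later while that
    Dirichlet solution does not, [w] would be zero from [r] on, against
    [w (r.+1 * K) = lam ^ r.+1 * w 0]. *)
Lemma expanding_part_neq0 a r : floquet_part k (dirichlet v a) lam^-1 r != 0.
Proof.
have wK := floquet_partM vK (solution_dirichlet v a) lamE (mulfV lam_neq0).
have wsol := solution_floquet vK lam^-1 (solution_dirichlet v a).
set w := floquet_part _ _ _ in wsol wK *.
apply/eqP => wr0.
(* At [0] the subtracted term is absent, so this is the hypothesis [dirichletK]. *)
have w0 : w 0%N != 0 by rewrite /w /floquet_part mulr0 subr0 add0n dirichletK.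
have shift := solutionE (solution_shift r wsol).
cbn beta in shift; rewrite !add0n wr0 in shift.
have wr1 : w r.+1 = 0.
  have := shift k; rewrite addnC -[in LHS](mul1n K) wK wr0 mulr0 mul0r subr0.
  by move/esym/eqP; rewrite mulf_eq0 (negPf (dirichletK _)) orbF add1n => /eqP.
have wge n : w (n.+1 + r)%N = 0 by rewrite shift add1n wr1 !mul0r subrr.
have : w (0 + r.+1 * K)%N = 0.
  by rewrite -(wge (k + r * k)%N); congr w; lia.
rewrite wK => /eqP; rewrite mulf_eq0 (negPf w0) orbF expf_eq0.
by rewrite (negPf lam_neq0) andbF.
Qed.

(** With [w] and [u] the growing and decaying Floquet parts, one has
    [(lam - lam^-1) * dirichlet v a (r + m * K) = lam ^ m * w r - lam ^ (- m) * u r];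
    for large [m] the second term is less than half of the first. *)
Lemma growth1 a r : exists N,
  (forall m, normc (dirichlet v a (r + m * K)) <= N%:R * normc lam ^+ m) /\
  (forall m, (N <= m)%N -> normc lam ^+ m <= N%:R * normc (dirichlet v a (r + m * K))).
Proof.
have wK := floquet_partM vK (solution_dirichlet v a) lamE (mulfV lam_neq0).
have lamE' : lam^-1 + lam = discriminant v k 0 by rewrite addrC.
have uK := floquet_partM vK (solution_dirichlet v a) lamE' (mulVf lam_neq0).
set w := floquet_part _ _ _ in wK; set u := floquet_part _ _ _ in uK.
have wr0 : 0 < normc (w r) by rewrite normc_gt0 expanding_part_neq0.
set L := normc lam.
have L1 m : 1 <= L ^+ m by rewrite exprn_ege1 // ltW.
have d0 : 0 < normc (lam - lam^-1) by rewrite normc_gt0 lam_sub_neq0.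
set d := normc (lam - lam^-1) in d0.
have S m : normc (dirichlet v a (r + m * K)) * d = normc (lam ^+ m * w r - lam^-1 ^+ m * u r).
  rewrite -normcM -wK -uK; congr normc; rewrite /w /u /floquet_part; ring.
have Vm m : normc (lam^-1 ^+ m * u r) <= normc (u r).
  rewrite normcM normcX normcV exprVn ler_piMl ?normc_ge0 //.
  by rewrite invf_le1 // (lt_le_trans ltr01 (L1 m)).
have [N1 H1] := nat_ge ((normc (w r) + normc (u r)) / d).
have [N2 H2] := nat_ge (2 * d / normc (w r)).
have [N3 H3] := exprn_unbounded (2 * normc (u r) / normc (w r)) lam1.
(* One integer serves as both constants and as the threshold for [m]. *)
exists (maxn N1 (maxn N2 N3)); split=> m.
  apply: le_trans (_ : (normc (w r) + normc (u r)) / d * L ^+ m <= _); last first.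
    rewrite ler_wpM2r ?(le_trans ler01) // H1 // leq_maxl //.
  rewrite mulrAC ler_pdivlMr // S.
  apply: le_trans (normc_subD _ _) _; rewrite mulrDl lerD //.
    by rewrite normcM normcX mulrC.
  by apply: le_trans (Vm m) _; rewrite ler_peMr ?normc_ge0.
rewrite !geq_max => /and3P[_ _ m3].
apply: le_trans (_ : 2 * d / normc (w r) * normc (dirichlet v a (r + m * K)) <= _); last first.
  by rewrite ler_wpM2r ?normc_ge0 // H2 // leq_max leq_maxl orbT.
rewrite mulrAC ler_pdivlMr // -mulrA [d * _]mulrC S.
have := H3 m m3; rewrite ler_pdivrMr // => {}H3.
have := le_trans (lerB (lexx _) (Vm m)) (normc_sub (lam ^+ m * w r) (lam^-1 ^+ m * u r)).
rewrite normcM normcX -/L; lra.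
Qed.

(** By periodicity only finitely many pairs of a base and a residue occur,
    so the constants of [growth1] can be chosen uniformly. *)
Lemma growth : exists N,
  (forall a n, normc (dirichlet v a n) <= N%:R * normc lam ^+ (n %/ K)) /\
  (forall a n, (N <= n)%N ->
     normc lam ^+ (n %/ K) <= N%:R * normc (dirichlet v a n)).
Proof.
have /choice[f Hf] : forall ar : nat * nat, exists N,
  (forall m, normc (dirichlet v ar.1 (ar.2 + m * K)) <= N%:R * normc lam ^+ m) /\
  (forall m, (N <= m)%N -> normc lam ^+ m <= N%:R * normc (dirichlet v ar.1 (ar.2 + m * K))).
  by case=> a r; exact: growth1.
pose M := \max_(ar : 'I_K * 'I_K) f (val ar.1, val ar.2).
have fM a r : (f (a %% K, r %% K) <= M)%N.
  have ltK x : (x %% K < K)%N by rewrite ltn_mod.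
  exact: (leq_bigmax (F := fun ar : 'I_K * 'I_K => f (val ar.1, val ar.2))
            (Ordinal (ltK a), Ordinal (ltK r))).
have L0 m : 0 <= normc lam ^+ m by rewrite exprn_ge0 ?normc_ge0.
exists (M.+1 * K)%N; split=> a n; rewrite (dirichlet_mod vK).
  rewrite {1}(divn_eq n K) addnC.
  have [H _] := Hf (a %% K, n %% K)%N; apply: le_trans (H _) _.
  by rewrite ler_wpM2r // ler_nat (leq_trans (fM a n)) // mulSn; lia.
move=> nM; rewrite {2}(divn_eq n K) addnC.
have [_ H] := Hf (a %% K, n %% K)%N; apply: le_trans (H _ _) _.
  by rewrite leq_divRL // (leq_trans _ nM) // leq_mul2r ltnW ?orbT // ltnS fM.
by rewrite ler_wpM2r ?normc_ge0 // ler_nat (leq_trans (fM a n)) //; lia.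
Qed.
End Growth.

(** * Green's function of a finite section *)

Section Green.
Opaque dirichlet.
Context {F : fieldType}.
Variables (v : nat -> F) (c m : nat).

Definition jacobi : 'M[F]_m :=
  \matrix_(i, j) ((j.+1 == i)%:R + (j == i.+1 :> nat)%:R
                  + v (c + i)%N * (j == i)%:R).

(** Cramer's rule for a tridiagonal matrix: the minor obtained by deleting
    row [j] and column [i] is the product of the determinants of the sections
    to the left of [minn i j] and to the right of [maxn i j]. *)
Definition green_entry (i j : nat) : F :=
  (-1) ^+ (i + j) * dirichlet v c (minn i j).+1
  * dirichlet v (c + (maxn i j).+1) (m - maxn i j) / dirichlet v c m.+1.

Definition green : 'M[F]_m := \matrix_(i, j) green_entry i j.

(** The value [g m = 0] beyond the last site lets the last row follow the
    same formula as the others. *)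
Lemma jacobi_row (g : nat -> F) (i : 'I_m) : g m = 0 ->
  \sum_(j < m) jacobi i j * g j =
  (if val i is i'.+1 then g i' else 0) + g i.+1 + v (c + i)%N * g i.
Proof.
move=> gm.
under eq_bigr do rewrite mxE !mulrDl -mulrA.
rewrite !big_split -mulr_sumr /=.
have pick (n : nat) : (n < m)%N -> \sum_(j < m) (j == n :> nat)%:R * g j = g n.
  move=> nm; rewrite (bigD1 (Ordinal nm)) //= eqxx mul1r big1 ?addr0 // => j.
  by rewrite -val_eqE /= => /negPf ->; rewrite mul0r.
have npick (P : pred nat) : (forall j, (j < m)%N -> ~~ P j) ->
    \sum_(j < m) (P j)%:R * g j = 0.
  by move=> H; apply: big1 => j _; rewrite (negPf (H _ _)) ?mul0r.
congr (_ + _ + _).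
- case: i => [[|i] im] /=; first exact: (npick (fun j => j.+1 == 0%N)).
  under eq_bigr do rewrite eqSS.
  by rewrite pick // ltnW.
- have [im|im] := ltnP i.+1 m; first exact: pick.
  have -> : i.+1 = m by apply/eqP; rewrite eqn_leq im ltn_ord.
  by rewrite gm; apply: (npick (pred1 m)) => j jm /=; rewrite neq_ltn jm.
- by congr (_ * _); exact: (pick (val i) (ltn_ord i)).
Qed.

Hypothesis Dm : dirichlet v c m.+1 != 0.

(** Off the diagonal this is the recursion for one of the two factors (in
    its right or left form); on the diagonal it is [dirichlet_add]. *)
Lemma jacobi_green : jacobi *m green = 1%:M.
Proof.
apply/matrixP => i j; rewrite !mxE.
under eq_bigr do rewrite [green _ _]mxE.
rewrite (jacobi_row (g := fun l => green_entry l j)); last first.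
  by rewrite /green_entry (maxn_idPl (ltnW (ltn_ord j))) subnn mulr0 mul0r.
rewrite -val_eqE /=.
case: i j => [i im] [j jm] /=.
have lrec : dirichlet v (c + i) (m - i).+1
    = v (c + i)%N * dirichlet v (c + i).+1 (m - i) - dirichlet v (c + i.+1).+1 (m - i.+1).
  by have := dirichlet_lrec v (c + i) (m - i.+1); rewrite subnSK // addnS.
have [ij|ji|<-] := ltngtP i j.
- have -> : (if i is i'.+1 then green_entry i' j else 0) =
    - ((-1) ^+ (i + j) * dirichlet v c i * dirichlet v (c + j).+1 (m - j) / dirichlet v c m.+1).
    case: i {im lrec} ij => [|i] ij; first by rewrite /= mulr0 !mul0r oppr0.
    rewrite /green_entry (maxn_idPr _) ?(minn_idPl _); try lia.
    by rewrite addSn exprS !mulNr opprK !mul1r addnS.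
  rewrite /green_entry (maxn_idPr ij) (minn_idPl ij).
  rewrite (maxn_idPr (ltnW ij)) (minn_idPl (ltnW ij)).
  rewrite (dirichletSS v c i) addnS addSn exprS mulr0n; field.
  exact: Dm.
- case: i im lrec ji => // i im lrec ji.
  have ji' : (j <= i)%N by [].
  rewrite /green_entry (minn_idPr ji') (maxn_idPl ji').
  rewrite (minn_idPr (ltnW ji)) (maxn_idPl (ltnW ji)).
  rewrite (minn_idPr (leqW (ltnW ji))) (maxn_idPl (leqW (ltnW ji))).
  rewrite (subnSK (ltnW im)) in lrec.
  rewrite !addnS !addSn in lrec *.
  rewrite lrec !exprS mulr0n; field; exact: Dm.
have -> : (if i is i'.+1 then green_entry i' i else 0) =
    - (dirichlet v c i * dirichlet v (c + i).+1 (m - i) / dirichlet v c m.+1).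
  case: i {im lrec} => [|i]; first by rewrite /= !mul0r oppr0.
  rewrite /green_entry (maxn_idPr _) ?(minn_idPl _); try lia.
  by rewrite addnS exprS -signr_odd addnn odd_double expr0 mulr1 addnS !mulNr !mul1r.
rewrite /green_entry maxnn minnn (maxn_idPl (leqnSn i)) (minn_idPr (leqnSn i)).
rewrite addSn exprS -signr_odd addnn odd_double expr0.
have := dirichlet_add v c i (m - i); rewrite subnKC 1?ltnW // lrec => add.
rewrite !addnS in add *; rewrite -add mulr1n.
have := Dm; rewrite -add => D; field.
exact: D.
Qed.

Lemma jacobi_unit : jacobi \in unitmx.
Proof. by have [] := mulmx1_unit jacobi_green. Qed.

Lemma invmx_jacobi : invmx jacobi = green.
Proof.
by rewrite -[RHS](mulKmx jacobi_unit) jacobi_green mulmx1.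
Qed.

End Green.

(** * Norms of finitely supported vectors and Schur's test *)

Section LpNorm.
Local Open Scope classical_set_scope.
Local Open Scope ring_scope.
Context {R : realType}.
Local Notation C := R[i].
Implicit Types (I : choiceType) (r M : R).

(** Young's inequality for the product [u * 1]. *)
Lemma bernoulli_powR r u : 1 <= r -> 0 <= u -> r * u <= u `^ r + (r - 1).
Proof.
rewrite le_eqVlt => /predU1P[<-|r1] u0; first by rewrite powRr1 // mul1r subrr addr0.
have r0 : 0 < r by lra.
have rn0 : r != 0 by rewrite gt_eqF.
have r1n0 : r - 1 != 0 by rewrite subr_eq0 gt_eqF.
have := @conjugate_powR R u 1 r (r / (r - 1)) u0 ler01 r0.
rewrite mulr1 powR1 => young.
have {}young : u <= u `^ r / r + 1 / (r / (r - 1)).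
  apply: young; first by rewrite divr_gt0 // subr_gt0.
  by field; rewrite ?rn0 ?r1n0.
have : r * u <= r * (u `^ r / r + 1 / (r / (r - 1))) by rewrite ler_pM2l.
by congr (_ <= _); field; rewrite ?rn0 ?r1n0.
Qed.

(** Jensen's inequality for a sub-probability weight [w / S], obtained by
    summing the tangent line inequality of [t `^ r] at the mean
    [(\sum_j w j * y j) / S]. *)
Lemma power_mean (J : finType) (w y : J -> R) r S : 1 <= r -> 0 < S ->
  (forall j, 0 <= w j) -> (forall j, 0 <= y j) -> \sum_j w j <= S ->
  (\sum_j w j * y j) `^ r * S <= S `^ r * \sum_j w j * y j `^ r.
Proof.
move=> r1 S0 w0 y0 wS; move defA : (\sum_j w j * y j) => A.
have rn0 : r != 0 by rewrite gt_eqF // (lt_le_trans ltr01).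
have : 0 <= A by rewrite -defA; apply: sumr_ge0 => j _; rewrite mulr_ge0.
rewrite le_eqVlt => /predU1P[<-|A0].
  rewrite powR0 // mul0r mulr_ge0 ?powR_ge0 // sumr_ge0 // => j _.
  by rewrite mulr_ge0 // powR_ge0.
have t0 : 0 < A / S by rewrite divr_gt0.
have tr0 : 0 < (A / S) `^ r by rewrite powR_gt0.
have AE : A `^ r = S `^ r * (A / S) `^ r.
  by rewrite -powRM ?(ltW S0) ?(ltW t0) // mulrCA divff ?mulr1 // gt_eqF.
rewrite AE -mulrA ler_pM2l ?powR_gt0 //.
have : \sum_j w j * (r * (y j / (A / S))) <= \sum_j w j * ((y j / (A / S)) `^ r + (r - 1)).
  apply: ler_sum => j _; rewrite ler_wpM2l // bernoulli_powR //.
  by rewrite divr_ge0 // ltW.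
have -> : \sum_j w j * (r * (y j / (A / S))) = r * S.
  transitivity (A * (r / (A / S))); last by field; rewrite !gt_eqF.
  rewrite -[X in _ = X * _]defA [RHS]mulr_suml; apply: eq_bigr => j _; ring.
have -> : \sum_j w j * ((y j / (A / S)) `^ r + (r - 1)) =
   (\sum_j w j * y j `^ r) / (A / S) `^ r + (\sum_j w j) * (r - 1).
  rewrite !mulr_suml -big_split; apply: eq_bigr => j _ /=.
  have -> : (y j / (A / S)) `^ r = y j `^ r / (A / S) `^ r.
    rewrite (powRM _ (y0 j)) ?invr_ge0 ?(ltW t0) //.
    by rewrite -powR_inv1 ?(ltW t0) // powRAC powR_inv1 ?powR_ge0.
  by rewrite mulrDr mulrA.
move=> H.
have {}H : S <= (\sum_j w j * y j `^ r) / (A / S) `^ r.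
  have : (\sum_j w j) * (r - 1) <= S * (r - 1) by rewrite ler_wpM2r // subr_ge0.
  lra.
by rewrite mulrC -ler_pdivlMr.
Qed.

Lemma lpnorm_le I r (x : I -> C) M : 1 <= r -> 0 <= M ->
  (lpnorm r%:E x <= M%:E)%E =
  (\esum_(i in [set: I]) (normc (x i) `^ r)%:E <= (M `^ r)%:E)%E.
Proof.
move=> r1 M0; rewrite /lpnorm.
have rn0 : r != 0 by rewrite gt_eqF // (lt_le_trans ltr01).
have r0 : 0 <= r by apply: le_trans r1.
have E0 : (0 <= \esum_(i in [set: I]) (normc (x i) `^ r)%:E)%E.
  by apply: esum_ge0 => i _; rewrite lee_fin powR_ge0.
apply/idP/idP => H.
  rewrite -[leLHS]poweRe1 // -(mulVf rn0) poweRrM -poweR_EFin.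
  by rewrite gt0_ler_poweR // in_itv /= ?lee_fin ?M0 ?poweR_ge0 ?leey.
rewrite -[M%:E]poweRe1 ?lee_fin // -(mulfV rn0) poweRrM poweR_EFin.
by rewrite gt0_ler_poweR ?invr_ge0 // in_itv /= ?E0 ?lee_fin ?powR_ge0 ?leey.
Qed.

Lemma esum_seq I (s : seq I) (f : I -> R) : uniq s -> (forall i, 0 <= f i) ->
  (forall i, i \notin s -> f i = 0) ->
  \esum_(i in [set: I]) (f i)%:E = (\sum_(i <- s) f i)%:E.
Proof.
move=> us f0 fs.
transitivity (\esum_(i in [set` s]) (f i)%:E).
  rewrite [RHS]esum_mkcond; apply: eq_esum => i _.
  by case: ifPn => // /negP; rewrite inE /= => /negP /fs ->.
rewrite esum_fset; [|exact: finite_seq|by move=> i _; rewrite lee_fin].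
by rewrite -fsbig_seq // sumEFin.
Qed.

Lemma esum_seq_ge I (s : seq I) (f : I -> R) : uniq s ->
  ((\sum_(i <- s) f i)%:E <= \esum_(i in [set: I]) (f i)%:E)%E.
Proof.
move=> us; apply: esum_ge; exists [set` s].
  by split => //; exact: finite_seq.
by rewrite -fsbig_seq // sumEFin.
Qed.

Lemma esum_fin (J : finType) (f : J -> R) : (forall i, 0 <= f i) ->
  \esum_(i in [set: J]) (f i)%:E = (\sum_i f i)%:E.
Proof.
move=> f0; rewrite (@esum_seq _ (index_enum J)) ?index_enum_uniq // => i.
by rewrite mem_index_enum.
Qed.

Lemma lpnormy_le I (x : I -> C) M :
  (lpnorm +oo%E x <= M%:E)%E <-> forall i, normc (x i) <= M.
Proof.
split=> [H i|H].
  rewrite -lee_fin; apply: le_trans H; rewrite /lpnorm.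
  by apply: ereal_sup_ubound; exists i.
by apply: ge_ereal_sup => _ [i _ <-]; rewrite lee_fin.
Qed.

Lemma normc_sum (J : finType) (f : J -> C) : normc (\sum_j f j) <= \sum_j normc (f j).
Proof.
elim/big_ind2: _ => [|x1 x2 y1 y2 H1 H2|//]; first by rewrite normc0.
by apply: le_trans (le_normcD _ _) _; rewrite lerD.
Qed.

(** For finite [p], convexity within each row bounds the [p]-th power of an
    entry of the image by a weighted sum of [p]-th powers, and exchanging the
    sums brings in the column bound; for [p = +oo] the row bound suffices. *)
Lemma schur_test m (G : 'M[C]_m) (p : \bar R) S : (1 <= p)%E -> 0 < S ->
  (forall i, \sum_j normc (G i j) <= S) -> (forall j, \sum_i normc (G i j) <= S) ->
  (opnorm p (mx_operator G) <= S%:E)%E.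
Proof.
move=> p1 S0 row col; apply: ge_ereal_sup => _ [x /= x1 <-].
have Gx i : normc (mx_operator G x i) <= \sum_j normc (G i j) * normc (x j).
  apply: le_trans (normc_sum _) _; apply: ler_sum => j _; by rewrite normcM.
case: p p1 x1 => [r|_|//]; last first.
  move=> /lpnormy_le x1; apply/lpnormy_le => i.
  apply: le_trans (Gx i) _; apply: le_trans (row i).
  by apply: ler_sum => j _; rewrite ler_piMr ?normc_ge0.
rewrite lee_fin => r1; rewrite !lpnorm_le ?(ltW S0) ?ler01 //.
have pw0 z : 0 <= normc z `^ r by exact: powR_ge0.
rewrite !(esum_fin (fun _ => pw0 _)) !lee_fin powR1 => x1.
rewrite -(ler_pM2r S0) mulr_suml.
apply: le_trans (_ : \sum_i S `^ r * \sum_j normc (G i j) * normc (x j) `^ r <= _).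
  apply: ler_sum => i _.
  apply: le_trans (power_mean r1 S0 _ _ (row i)); try by move=> j; exact: normc_ge0.
  rewrite ler_wpM2r ?(ltW S0) // ge0_ler_powR ?nnegrE ?normc_ge0 //.
    exact: le_trans r1.
  by apply: sumr_ge0 => j _; rewrite mulr_ge0 ?normc_ge0.
rewrite -mulr_sumr ler_wpM2l ?powR_ge0 // exchange_big /=.
apply: le_trans (_ : \sum_j S * normc (x j) `^ r <= _).
  by apply: ler_sum => j _; rewrite -mulr_suml ler_wpM2r.
by rewrite -mulr_sumr ler_piMr // ltW.
Qed.

End LpNorm.

(** * Uniform bounds for the inverses of the sections *)

Section Stability.
Context {R : realType}.
Local Notation C := R[i].

Section Geometric.
Variables (rho : R) (k : nat).
Hypothesis rho01 : 0 <= rho < 1.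
Local Notation K := k.+1.

Lemma rho_pow n : 0 <= rho ^+ n <= 1.
Proof.
by case/andP: rho01 => r0 r1; rewrite exprn_ge0 //= exprn_ile1 // ltW.
Qed.

(** The exponent [d %/ K] is constant on blocks of length [K], so what follows
    the first block is [rho] times a shorter sum of the same kind. *)
Lemma staircase_sum n : \sum_(0 <= d < n) rho ^+ (d %/ K) <= K%:R / (1 - rho).
Proof.
have r1 : 0 < 1 - rho by rewrite subr_gt0; case/andP: rho01.
have r0 : 0 <= rho by case/andP: rho01.
rewrite ler_pdivlMr //.
have small j : (j <= K)%N -> \sum_(0 <= d < j) rho ^+ (d %/ K) <= K%:R.
  move=> jK; apply: le_trans (_ : \sum_(0 <= d < j) 1 <= _).
    by apply: ler_sum => d _; case/andP: (rho_pow (d %/ K)).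
  by rewrite sumr_const_nat subn0 ler_nat.
elim/ltn_ind: n => n IH; have [nK|nK] := leqP n K.
  apply: le_trans (_ : K%:R * 1 <= _); last by rewrite mulr1.
  by rewrite ler_pM ?small ?(ltW r1) ?lerBlDr ?lerDl // sumr_ge0 // => d _; rewrite exprn_ge0.
rewrite (big_cat_nat _ (n := K)) ?(ltnW nK) //=.
have -> : \sum_(K <= d < n) rho ^+ (d %/ K) =
    rho * \sum_(0 <= d < n - K) rho ^+ (d %/ K).
  rewrite -{1}[K]add0n big_addn mulr_sumr; apply: eq_bigr => d _.
  by rewrite divnDr ?dvdnn // divnn addn1 exprS.
have nKn : (n - K < n)%N by rewrite ltn_subrL (ltn_trans _ nK).
have := IH _ nKn; have := small K (leqnn K).
set a := \sum_(0 <= d < K) _; set b := \sum_(0 <= d < _) _ => aK bK.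
have : rho * (b * (1 - rho)) <= rho * K%:R by rewrite ler_wpM2l.
have : a * (1 - rho) <= K%:R * (1 - rho) by rewrite ler_wpM2r // ltW.
lra.
Qed.

Lemma staircase_row_sum m (i : 'I_m) :
  \sum_(j < m) rho ^+ ((maxn i j - minn i j) %/ K) <= 2 * (K%:R / (1 - rho)).
Proof.
have r0 : 0 <= rho by case/andP: rho01.
rewrite -(big_mkord xpredT (fun j => rho ^+ ((maxn i j - minn i j) %/ K))).
rewrite (big_cat_nat _ (n := i)) ?(ltnW (ltn_ord i)) //= mulr_natl mulr2n.
apply: lerD; last first.
  rewrite -{1}[val i]add0n big_addn.
  apply: le_trans (staircase_sum (m - i)); apply: ler_sum => d _.
  by rewrite (maxn_idPr (leq_addl _ _)) (minn_idPl (leq_addl _ _)) addnK.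
apply: le_trans (staircase_sum i); rewrite big_nat_rev big_seq [leRHS]big_seq.
apply: ler_sum => d; rewrite mem_index_iota /= add0n => di.
have ii : (i - d.+1 <= i)%N by rewrite leq_subr.
rewrite (maxn_idPl ii) (minn_idPr ii) subKn //.
have /subnK <- : (d %/ K <= d.+1 %/ K)%N by rewrite leq_div2r.
rewrite exprD ler_piMl ?exprn_ge0 //.
by case/andP: (rho_pow (d.+1 %/ K - d %/ K)).
Qed.
End Geometric.

(** Two-sided growth turns the Green's function into an exponentially
    decaying kernel: the exponent in the denominator exceeds the one in the
    numerator by at least the number of whole periods between the two sites. *)
Lemma jacobi_stability (v : nat -> C) k (lam : C) :
  (forall j, v (j + k.+1)%N = v j) -> lam + lam^-1 = discriminant v k 0 ->
  1 < normc lam -> (forall a, dirichlet v a k.+1 != 0) ->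
  exists n0 S, forall c m, (n0 <= m)%N -> jacobi v c m \in unitmx /\
    forall p, (1 <= p)%E ->
      (opnorm p (mx_operator (invmx (jacobi v c m))) <= S%:E)%E.
Proof.
move=> vK lamE lam1 dK; have [N [up low]] := growth vK lamE lam1 dK.
set L := normc lam in lam1 up low; set K := k.+1 in dK up low.
have L0 : 0 < L by apply: lt_trans lam1.
have Lm0 m : 0 < L ^+ m by rewrite exprn_gt0.
pose S := N%:R ^+ 3 * (2 * (K%:R / (1 - L^-1))) + 1.
have rho01 : 0 <= L^-1 < 1 by rewrite invr_ge0 ltW //= invf_lt1.
exists N, S => c m Nm.
have lowm := low c m.+1 (leqW Nm).
have D0 : dirichlet v c m.+1 != 0.
  apply/eqP => D0; move: lowm; rewrite D0 normc0 mulr0.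
  by rewrite leNgt Lm0.
split=> [|p p1]; first exact: jacobi_unit.
rewrite invmx_jacobi //.
have ent i j : (i < m)%N -> (j < m)%N ->
   normc (green_entry v c m i j) <= N%:R ^+ 3 * L^-1 ^+ ((maxn i j - minn i j) %/ K).
  move=> im jm; rewrite /green_entry !normcM normcV normcX.
  rewrite normcN normc1 expr1n mul1r.
  have ji : (minn i j <= maxn i j)%N by rewrite geq_min leq_maxl.
  have : (maxn i j < m)%N by rewrite gtn_max im.
  move: (minn i j) (maxn i j) ji => a b ab bm.
  have upa := up c a.+1; have upb := up (c + b.+1)%N (m - b)%N.
  have Dg : 0 < normc (dirichlet v c m.+1) by rewrite normc_gt0.
  rewrite ler_pdivrMr //.
  (* Quotients by the period are superadditive. *)
  have LL : L ^+ (a.+1 %/ K) * L ^+ ((m - b) %/ K) * L ^+ ((b - a) %/ K) <= L ^+ (m.+1 %/ K).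
    rewrite -!exprD ler_weXn2l ?(ltW lam1) //.
    by rewrite leq_divRL // !mulnDl; have := leq_trunc_div a.+1 K;
       have := leq_trunc_div (m - b) K; have := leq_trunc_div (b - a) K; lia.
  apply: le_trans (_ : N%:R * L ^+ (a.+1 %/ K) * (N%:R * L ^+ ((m - b) %/ K)) <= _).
    by rewrite ler_pM ?normc_ge0 // addnS.
  rewrite exprVn [leRHS]mulrAC ler_pdivlMr //.
  apply: le_trans (_ : N%:R ^+ 2 * L ^+ (m.+1 %/ K) <= _).
    have -> : N%:R * L ^+ (a.+1 %/ K) * (N%:R * L ^+ ((m - b) %/ K)) * L ^+ ((b - a) %/ K)
      = N%:R ^+ 2 * (L ^+ (a.+1 %/ K) * L ^+ ((m - b) %/ K) * L ^+ ((b - a) %/ K)) by ring.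
    by rewrite ler_wpM2l // exprn_ge0.
  by rewrite (exprSr _ 2) -[leRHS]mulrA ler_wpM2l // exprn_ge0.
have N30 : 0 <= N%:R ^+ 3 :> R by rewrite exprn_ge0.
have row i : \sum_j normc (green v c m i j) <= S.
  apply: le_trans (_ : N%:R ^+ 3 * \sum_(j < m) L^-1 ^+ ((maxn i j - minn i j) %/ K) <= _).
    by rewrite mulr_sumr; apply: ler_sum => j _; rewrite mxE ent.
  apply: ler_wpDr => //; rewrite ler_wpM2l //; exact: staircase_row_sum.
apply: schur_test => // [|j].
  rewrite ltr_wpDl // mulr_ge0 // mulr_ge0 // divr_ge0 // subr_ge0.
  by case/andP: rho01 => _ /ltW.
apply: le_trans (row j); apply: ler_sum => i _.
by rewrite !mxE /green_entry maxnC minnC [(i + j)%N]addnC.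
Qed.
End Stability.

(** * Operators with an approximate kernel *)

Section ApproximateKernel.
Local Open Scope classical_set_scope.
Local Open Scope ring_scope.
Context {R : realType}.
Local Notation C := R[i].

(** The vectors [A x] are bounded by one on a finite set [s] that carries
    them, while [x] is at least [N] on a set [t] that is at most [b] times smaller.
    Counting points instead of taking norms makes the notion independent of
    [p]. *)
Definition approximate_kernel (I : choiceType) (b : nat)
    (A : (I -> C) -> (I -> C)) : Prop :=
  forall N : nat, exists x : I -> C, exists s t : seq I,
    [/\ uniq s, uniq t, (0 < size t)%N & (size s <= b * size t)%N] /\
    [/\ forall i, i \notin s -> x i = 0, forall i, i \notin s -> A x i = 0,
        forall i, normc (A x i) <= 1 & forall i, i \in t -> N%:R <= normc (x i)].

Lemma normcR (a : R) : normc a%:C%C = `|a|.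
Proof. by rewrite /normc /= expr0n addr0 sqrtr_sqr. Qed.

Lemma lp_finite_support (I : choiceType) (p : \bar R) (s : seq I) (x : I -> C) :
  (1 <= p)%E -> uniq s -> (forall i, i \notin s -> x i = 0) -> lp p x.
Proof.
case: p => [r||//] p1 us xs; rewrite /lp /mkset.
  apply: poweR_lty; rewrite (esum_seq us) ?ltry // => [i|i /xs ->].
    exact: powR_ge0.
  by rewrite normc0 powR0 // gt_eqF // (lt_le_trans ltr01).
apply: le_lt_trans (ltry (\sum_(i <- s) normc (x i))).
apply/lpnormy_le => i; have [si|/xs ->] := boolP (i \in s); last first.
  by rewrite normc0 sumr_ge0 // => j _; exact: normc_ge0.
rewrite (bigD1_seq i) //= lerDl sumr_ge0 // => j _; exact: normc_ge0.
Qed.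

(** After multiplication by [(b * size t) ^ (- 1 / p)] the vector [A x] lies
    in the unit ball, whereas the norm of [x] is at least [N / b]; the inverse
    operator would have to be unbounded. *)
Lemma not_invertible (I : choiceType) (p : \bar R) b (A : (I -> C) -> (I -> C)) :
  (0 < b)%N -> (1 <= p)%E -> approximate_kernel b A -> ~ invertible_operator p A.
Proof.
move=> b0 p1 kerA [[lpA _ _] [B [[_ linB bndB] BA]]].
have [M HM] : exists M : nat, (opnorm p B <= M%:R%:E)%E.
  case: (opnorm p B) bndB => [y _|//|_]; last by exists 0%N; rewrite leNye.
  by have [M HM] := nat_ge y; exists M; rewrite lee_fin HM.
have [x [s [t [[us ut t0 st] [xs Axs Ax1 xt]]]]] := kerA (b * M).+1.
have lx : lp p x := lp_finite_support p1 us xs.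
have l0 : lp p (0 : I -> C) by apply: (lp_finite_support (s := [::]) p1).
have B0 : B 0 = 0.
  by have := linB 1 0 0 l0 l0; rewrite !scale1r !addr0 => /eqP; rewrite -subr_eq subrr => /eqP.
have Bw (w : C) : B (w *: A x) = w *: x.
  have := linB w (A x) 0 (lpA _ lx) l0; rewrite !addr0 B0 addr0 => ->.
  by have [-> _] := BA _ lx.
have sE (c : C) (f : I -> C) i : (c *: f) i = c * f i by [].
have le w : (lpnorm p (w *: A x) <= 1)%E -> (lpnorm p (w *: x) <= M%:R%:E)%E.
  move=> H; apply: le_trans HM; apply: ereal_sup_ubound.
  by exists (w *: A x); rewrite ?Bw.
(* For [p = +oo] no rescaling is needed: one site of [t] is enough. *)
case: p p1 {lpA linB bndB BA HM lx l0} le => [r||//] p1 le; last first.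
  have /lpnormy_le H : (lpnorm +oo%E (1%:C%C *: x) <= M%:R%:E)%E.
    by apply: le; apply/lpnormy_le => i; rewrite sE normcM normc1 mul1r.
  case: t t0 {ut st} xt => // i t _ xt.
  have := H i; rewrite sE normcM normc1 mul1r => /(le_trans (xt i (mem_head _ _))).
  rewrite ler_nat.
  by rewrite leqNgt ltnS leq_pmull.
rewrite lee_fin in p1; have r0 : 0 < r by apply: lt_le_trans p1.
have rn0 : r != 0 by rewrite gt_eqF.
pose n := (b * size t)%N; have n0 : (0 < n)%N by rewrite muln_gt0 b0.
have nR0 : 0 < n%:R :> R by rewrite ltr0n.
(* With this factor a vector bounded by one on [n] points has norm at most one. *)
pose w : R := n%:R^-1 `^ r^-1.
have w0 : 0 <= w by exact: powR_ge0.
have wr : w `^ r = n%:R^-1 by rewrite -powRrM mulVf // powRr1 // invr_ge0 ltW.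
have wC (y : C) : normc (w%:C%C * y) `^ r = n%:R^-1 * normc y `^ r.
  by rewrite normcM normcR ger0_norm // powRM ?normc_ge0 // wr.
have : (lpnorm r%:E (w%:C%C *: x) <= M%:R%:E)%E.
  apply: le; rewrite lpnorm_le // (esum_seq us); last 2 first.
  - by move=> i; exact: powR_ge0.
  - by move=> i /Axs Ai; rewrite sE Ai mulr0 normc0 powR0.
  rewrite lee_fin powR1.
  apply: le_trans (_ : \sum_(i <- s) n%:R^-1 <= _).
    apply: ler_sum => i _; rewrite sE wC ler_piMr ?invr_ge0 ?(ltW nR0) //.
    have <- : 1 `^ r = 1 :> R by rewrite powR1.
    by rewrite ge0_ler_powR ?nnegrE ?normc_ge0 ?(ltW r0).
  rewrite big_const_seq count_predT iter_addr_0 -[leLHS]mulr_natl.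
  by rewrite ler_pdivrMr // mul1r ler_nat.
rewrite lpnorm_le // => /(le_trans (esum_seq_ge _ ut)); rewrite lee_fin => H.
have : \sum_(i <- t) n%:R^-1 * (b * M).+1%:R `^ r <= M%:R `^ r.
  apply: le_trans H; rewrite big_seq [leRHS]big_seq; apply: ler_sum => i it.
  rewrite sE wC ler_wpM2l ?invr_ge0 ?(ltW nR0) //.
  by rewrite ge0_ler_powR ?nnegrE ?normc_ge0 ?(ltW r0) // xt.
rewrite big_const_seq count_predT iter_addr_0 -[leLHS]mulr_natl mulrA.
have -> : (size t)%:R / n%:R = b%:R^-1 :> R.
  rewrite /n natrM; field.
  by rewrite !pnatr_eq0 -!lt0n b0 t0.
rewrite ler_pdivrMl ?ltr0n // leNgt => /negP; apply.
apply: le_lt_trans (_ : (b%:R * M%:R) `^ r < _).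
  rewrite powRM // ler_wpM2r ?powR_ge0 // le1r_powR // ler1n //.
by rewrite gt0_ltr_powR ?nnegrE // -?natrM ?ltr_nat ?ler0n.
Qed.
End ApproximateKernel.

(** * Non-invertibility for a unimodular multiplier *)

Section Unimodular.
Context {R : realType}.
Local Notation C := R[i].
Variables (v : nat -> C) (k : nat).
Local Notation K := k.+1.
Hypothesis vK : forall j, v (j + K)%N = v j.

(** The Floquet part of the Dirichlet solution works unless it vanishes
    identically, and then the Dirichlet solution is itself a Floquet solution
    for the other multiplier. *)
Lemma bounded_solution (lam : C) :
  lam + lam^-1 = discriminant v k 0 -> normc lam = 1 ->
  exists q, [/\ solution v 0 q, forall n, normc (q (n + K)%N) = normc (q n)
    & exists j, q j.+1 != 0].
Proof.
move=> lamE lam1.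
have lam0 : lam != 0 by rewrite -normc_gt0 lam1.
have sS := solution_dirichlet v 0.
have [[j qj]|q0] := pselect (exists j, floquet_part k (dirichlet v 0) lam^-1 j.+1 != 0).
  exists (floquet_part k (dirichlet v 0) lam^-1); split; last by exists j.
    exact: solution_floquet.
  move=> n; rewrite -[K in (n + K)%N]mul1n.
  by rewrite (floquet_partM vK sS lamE (mulfV lam0)) normcM normcX lam1 expr1n mul1r.
have {}q0 j : floquet_part k (dirichlet v 0) lam^-1 j.+1 = 0.
  by apply/eqP/negP => /negP qj; apply: q0; exists j.
have q00 j : floquet_part k (dirichlet v 0) lam^-1 j = 0.
  case: j => //; apply/eqP; rewrite -oppr_eq0.
  by have := solution_floquet vK lam^-1 sS 0; rewrite !q0 mulr0 sub0r => <-.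
exists (dirichlet v 0); split => //; last by exists 0%N; rewrite oner_neq0.
move=> n; have /eqP := q00 n; rewrite subr_eq0 => /eqP ->.
by rewrite normcM normcV lam1 invr1 mul1r.
Qed.

Variable q : nat -> C.
Hypothesis sq : solution v 0 q.
Hypothesis qK : forall n, normc (q (n + K)%N) = normc (q n).

Lemma normc_mod n m : normc (q (n + m * K)%N) = normc (q n).
Proof. by elim: m => [|m IH]; rewrite ?addn0 // mulSn addnCA addnC qK. Qed.

Lemma normc_bound : exists2 Q, 0 < Q & forall n, normc (q n) <= Q.
Proof.
exists (\sum_(i < K) normc (q i) + 1) => [|n].
  by rewrite ltr_wpDl // sumr_ge0 // => i _; exact: normc_ge0.
rewrite (divn_eq n K) addnC normc_mod.
rewrite (bigD1 (Ordinal (ltn_pmod n (ltn0Sn k)))) //= -addrA lerDl.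
by rewrite addr_ge0 // sumr_ge0 // => i _; exact: normc_ge0.
Qed.

Definition tent (l j : nat) := minn j (4 * l - j).

Definition tapered (c : R) l (j : nat) : C :=
  (c * (tent l j)%:R)%:C%C * ((-1) ^+ j * q j.+1).

(** A cutoff commutes with [H] up to its increments, and [H] kills the
    solution itself. *)
Lemma schrodinger_tapered c l j :
  schrodingerN v (tapered c l) j =
  (c%:C%C * (-1) ^+ j) * (((tent l j)%:R - (tent l j.-1)%:R)%:C%C * q j
    + ((tent l j)%:R - (tent l j.+1)%:R)%:C%C * q j.+2).
Proof.
have -> : schrodingerN v (tapered c l) j =
   - (c%:C%C * (-1) ^+ j * (tent l j.-1)%:R%:C%C * q j)
   + tapered c l j.+1 + v j * tapered c l j.
  congr (_ + _ + _); case: j => [|j]; first by rewrite /tent min0n mulr0 mul0r oppr0.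
  by rewrite /tapered rmorphM /= exprS; ring.
rewrite /tapered (sq j) add0n !rmorphB /= !rmorphM /= !exprS; ring.
Qed.

Lemma tent_step l i j : (i <= j.+1)%N -> (j <= i.+1)%N ->
  `|(tent l j)%:R - (tent l i)%:R| <= 1 :> R.
Proof.
move=> ij ji; rewrite ler_norml.
have : (tent l j)%:R <= (tent l i).+1%:R :> R by rewrite ler_nat /tent; lia.
have : (tent l i)%:R <= (tent l j).+1%:R :> R by rewrite ler_nat /tent; lia.
by rewrite -!natr1; lra.
Qed.

(** The tent has slope at most one, so [H] maps the tapered solution to a
    bounded vector on [4 l + 1] sites, while on the middle half of them the
    tent is at least [l] and [q] has a fixed size at one site per period. *)
Lemma tapered_floquet j0 : q j0.+1 != 0 -> forall N : nat,
  exists x : nat -> C, exists s t : seq nat,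
    [/\ uniq s, uniq t, (0 < size t)%N & (size s <= 5 * K * size t)%N] /\
    [/\ forall i, i \notin s -> x i = 0,
        forall i, i \notin s -> schrodingerN v x i = 0,
        forall i, normc (schrodingerN v x i) <= 1,
        forall i, i \in t -> N%:R <= normc (x i)
      & x 0%N = 0].
Proof.
move=> qj0 N; have [Q Q0 qQ] := normc_bound.
(* With the nonzero site in the first period, the points of [t] stay inside
   the middle half. *)
pose j1 := (j0 %% K)%N; set d := normc (q j1.+1).
have d0 : 0 < d.
  by rewrite /d -(normc_mod _ (j0 %/ K)) addSn addnC -divn_eq normc_gt0.
have [L0 HL] := nat_ge (N%:R * (2 * Q) / (d * K%:R)).
pose L := L0.+1; pose l := (K * L)%N; pose c := (2 * Q)^-1.
have c0 : 0 < c by rewrite invr_gt0 mulr_gt0.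
exists (tapered c l), (iota 0 (4 * l).+1), [seq (j1 + K * m)%N | m <- iota L L].
have tent0 j : (4 * l <= j)%N -> tent l j = 0%N by rewrite /tent; lia.
have stepbound j : normc (schrodingerN v (tapered c l) j) <= 1.
  rewrite schrodinger_tapered !normcM normcX normcN normc1 expr1n mulr1.
  rewrite normcR gtr0_norm // ler_pdivrMl ?mulr_gt0 // mulr1.
  apply: le_trans (le_normcD _ _) _; rewrite !normcM !normcR mulr_natl mulr2n.
  have tq i m : `|(tent l j)%:R - (tent l i)%:R| <= 1 :> R ->
      `|(tent l j)%:R - (tent l i)%:R| * normc (q m) <= Q.
    by move=> ti; rewrite -[Q]mul1r ler_pM ?normc_ge0.
  by rewrite lerD // tq // tent_step //; lia.
split; split => //.
- exact: iota_uniq.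
- rewrite map_inj_uniq ?iota_uniq // => a a' /addnI/eqP.
  by rewrite eqn_pmul2l // => /eqP.
  (* [t] has [L] points, and [4 * l + 1 <= 5 * l] with [l = K * L]. *)
- rewrite size_map !size_iota -mulnA -/l.
  have : (0 < l)%N by rewrite muln_gt0.
  lia.
- move=> i; rewrite mem_iota /= add0n -leqNgt => il.
  by rewrite /tapered tent0 ?mulr0 ?mul0r // ltnW.
- move=> i; rewrite mem_iota /= add0n -leqNgt => il.
  rewrite schrodinger_tapered !tent0 ?subrr ?mul0r ?addr0 ?mulr0 //; lia.
- move=> i /mapP[m]; rewrite mem_iota => /andP[Lm mL] ->.
  have jK : (j1 < K)%N by rewrite ltn_mod.
  have tl : (l <= tent l (j1 + K * m))%N.
    have : (K * L <= K * m)%N by rewrite leq_mul2l Lm orbT.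
    have : (K * m.+1 <= K * (L + L))%N by rewrite leq_mul2l mL orbT.
    by rewrite /tent /l mulnS mulnDr; lia.
  rewrite /tapered !normcM normcX normcN normc1 expr1n mul1r normcR.
  rewrite -addSn [(K * m)%N]mulnC normc_mod -/d.
  rewrite ger0_norm ?mulr_ge0 ?(ltW c0) // mulrAC.
  apply: le_trans (_ : c * d * l%:R <= _); last first.
    by rewrite ler_wpM2l ?mulr_ge0 ?(ltW c0) ?(ltW d0) // ler_nat mulnC.
  have := HL L (leqnSn _); rewrite ler_pdivrMr ?mulr_gt0 ?ltr0n // => {}HL.
  rewrite /c -mulrA ler_pdivlMl ?mulr_gt0 // mulrC.
  by have -> : d * l%:R = L%:R * (d * K%:R) by rewrite /l natrM; ring.
- by rewrite /tapered /tent min0n mulr0 mul0r.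
Qed.

End Unimodular.

Section NotInvertible.
Context {R : realType}.
Local Notation C := R[i].

Lemma approximate_kernelN (v : nat -> C) k lam :
  (forall j, v (j + k.+1)%N = v j) ->
  lam + lam^-1 = discriminant v k 0 -> normc lam = 1 ->
  approximate_kernel (5 * k.+1) (schrodingerN v).
Proof.
move=> vK lamE lam1 N.
have [q [sq qK [j0 qj0]]] := bounded_solution vK lamE lam1.
have [x [s [t [H [H1 H2 H3 H4 _]]]]] := tapered_floquet sq qK qj0 N.
by exists x, s, t.
Qed.

Definition extend0 (x : nat -> C) (i : int) : C := if i is Posz n then x n else 0.

(** Since [x 0 = 0], the half-line boundary condition is invisible to the
    operator on the whole line. *)
Lemma schrodinger_extend0 (v : int -> C) (x : nat -> C) : x 0%N = 0 ->
  schrodingerZ v (extend0 x) = extend0 (schrodingerN (fun n => v n%:Z) x).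
Proof.
move=> x0; apply/funext => -[[|n]|n]; rewrite /schrodingerZ.
- by [].
- have -> : n.+1%:Z - 1 = n%:Z by rewrite -addn1 PoszD addrK.
  by have -> : n.+1%:Z + 1 = n.+2%:Z by rewrite -PoszD addn1.
- have -> : Negz n - 1 = Negz n.+1 by rewrite !NegzE -[in RHS]addn1 PoszD opprD.
  by case: n => [|n]; rewrite [LHS]/= ?x0 mulr0 !addr0.
Qed.

Lemma approximate_kernelZ (v : int -> C) k lam :
  (forall j : nat, v (j + k.+1)%N = v j) ->
  lam + lam^-1 = discriminant (fun n => v n%:Z) k 0 -> normc lam = 1 ->
  approximate_kernel (5 * k.+1) (schrodingerZ v).
Proof.
move=> vK lamE lam1 N.
have [q [sq qK [j0 qj0]]] := bounded_solution vK lamE lam1.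
have [x [s [t [[us ut t0 st] [xs Axs Ax1 xt x0]]]]] := tapered_floquet sq qK qj0 N.
have Pinj : injective Posz by move=> a b [].
exists (extend0 x), (map Posz s), (map Posz t).
rewrite !size_map !(map_inj_uniq Pinj) schrodinger_extend0 //.
split; split => //.
- by move=> [n|//]; rewrite mem_map // => /xs.
- by move=> [n|//]; rewrite mem_map // => /Axs.
- by move=> [n|n]; [exact: Ax1 | rewrite [extend0 _ _]/= normc0 ler01].
- by move=> i /mapP[n nt ->] /=; exact: xt.
Qed.

End NotInvertible.

(** * A criterion for FSM-simplicity *)

Section Criterion.
Local Open Scope classical_set_scope.
Local Open Scope ring_scope.
Context {R : realType}.
Local Notation C := R[i].

(** The roots of [X ^ 2 - t * X + 1] are inverse to each other, so one of
    them has modulus at least one. *)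
Lemma floquet_multiplier (t : C) : exists lam : C, lam + lam^-1 = t /\ 1 <= normc lam.
Proof.
pose s := sqrtC (t ^+ 2 - 4); have s2 : s ^+ 2 = t ^+ 2 - 4 by rewrite sqrtCK.
pose x := (t + s) / 2; pose y := (t - s) / 2.
have two : (2 : C) != 0 by rewrite pnatr_eq0.
have xy : x * y = 1.
  transitivity ((t ^+ 2 - s ^+ 2) / 4); first by rewrite /x /y; field.
  by rewrite s2; field.
have xDy : x + y = t by rewrite /x /y; field.
have x0 : x != 0 by apply/eqP => x0; move/eqP: xy; rewrite x0 mul0r eq_sym oner_eq0.
have y0 : y != 0 by apply/eqP => y0; move/eqP: xy; rewrite y0 mulr0 eq_sym oner_eq0.
have xV : x^-1 = y by apply: (mulfI x0); rewrite xy mulfV.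
have yV : y^-1 = x by rewrite -xV invrK.
have [x1|/ltW x1] := leP 1 (normc x); first by exists x; rewrite xV.
exists y; rewrite yV addrC; split=> //.
by rewrite -xV normcV invf_ge1 // normc_gt0.
Qed.

(** Whenever the Dirichlet vector at some site is an eigenvector of the
    period matrix, its eigenvalue is 1 or -1. *)
Definition dirichlet_unimodular (v : nat -> C) K :=
  forall a, dirichlet v a K = 0 -> dirichlet v a K.+1 ^+ 2 = 1.

(** If [dirichlet v a K] vanished, [dirichlet v a K.+1] would be an
    eigenvalue of the period matrix equal to 1 or -1, but the eigenvalues are
    [lam] and [lam^-1]. *)
Lemma dirichlet_noneigen (v : nat -> C) k lam :
  (forall j, v (j + k.+1)%N = v j) ->
  lam + lam^-1 = discriminant v k 0 -> 1 < normc lam ->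
  dirichlet_unimodular v k.+1 -> forall a, dirichlet v a k.+1 != 0.
Proof.
move=> vK lamE lam1 uni a; apply/eqP => Da.
have lam0 : lam != 0 by rewrite -normc_gt0; apply: lt_trans lam1.
have := dirichlet_wronskian v a k; rewrite Da mul0r subr0.
have := uni a Da; move: lamE.
rewrite -(discriminant_const vK a) /discriminant.
set x := dirichlet v a k.+2; move: (dirichlet _ _ _) => y lamE x2 xy.
have yE : y = - x by rewrite -[y]mul1r -x2 expr2 -mulrA xy mulrN1.
have : (lam - x) ^+ 2 = 0.
  have -> : (lam - x) ^+ 2 = lam * (lam + lam^-1) - 1 - 2 * x * lam + x ^+ 2 by field.
  by rewrite lamE yE x2; ring.
move/eqP; rewrite expf_eq0 /= subr_eq0 => /eqP lx.
have : normc lam ^+ 2 = 1 by rewrite -normcX lx x2 normc1.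
by apply/eqP; rewrite gt_eqF // exprn_egt1.
Qed.

Lemma finite_sectionN_jacobi (v : nat -> C) n :
  finite_sectionN (schrodingerN v) n = jacobi v 0 n.+1.
Proof.
apply/matrixP => i j; rewrite !mxE /entry /schrodingerN /unit_vector add0n.
rewrite [(i.+1 == j)%N]eq_sym [(val i == j)]eq_sym; congr (_ + _ + _ * _).
by case: (val i) => // i'; rewrite eqSS eq_sym.
Qed.

(** Adding [n] periods moves the left end [- n] of the section to the site
    [k * n], so that only natural base points are needed. *)
Lemma finite_sectionZ_jacobi (v : int -> C) k n :
  (forall j, v (j + k.+1%:Z) = v j) ->
  finite_sectionZ (schrodingerZ v) n = jacobi (fun j => v j%:Z) (k * n) n.*2.+1.
Proof.
move=> vK; apply/matrixP => i j; rewrite !mxE /entry /schrodingerZ /unit_vector.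
have vKn m z : v (z + (m * k.+1)%:Z) = v z.
  elim: m => [|m IH]; first by rewrite addr0.
  by rewrite mulSn addnC PoszD addrA vK.
congr (_%:R + _%:R + _ * _%:R).
- by congr nat_of_bool; lia.
- by congr nat_of_bool; lia.
- rewrite -(vKn n); congr v; nia.
- by congr nat_of_bool; rewrite -val_eqE /=; lia.
Qed.

(** The two cases for the modulus of the larger multiplier: if it is one,
    the operator is not invertible; otherwise all long sections have uniformly
    bounded inverses. *)
Lemma FSM_simple_of_sections (I : choiceType) (p : \bar R) (A : (I -> C) -> (I -> C))
    (d : nat -> nat) (M : forall n, 'M[C]_(d n)) (v : nat -> C) (c : nat -> nat) k b :
  (1 <= p)%E -> (forall j, v (j + k.+1)%N = v j) -> dirichlet_unimodular v k.+1 ->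
  (0 < b)%N ->
  (forall lam, lam + lam^-1 = discriminant v k 0 -> normc lam = 1 ->
     approximate_kernel b A) ->
  (forall n, M n = jacobi v (c n) (d n)) -> (forall n, (n <= d n)%N) ->
  FSM_simple p A M.
Proof.
move=> p1 vK uni b0 kerA ME dn.
have [lam [lamE]] := floquet_multiplier (discriminant v k 0).
rewrite le_eqVlt => /predU1P[/esym lam1|lam1].
  by right; apply: not_invertible b0 p1 _; exact: kerA lamE lam1.
have [invA|] := pselect (invertible_operator p A); last by right.
left; split=> //.
have dK := dirichlet_noneigen vK lamE lam1 uni.
have [n0 [S stab]] := jacobi_stability vK lamE lam1 dK.
exists n0; split=> [n n0n|].
  by rewrite ME; have [] := stab (c n) (d n) (leq_trans n0n (dn n)).
apply: le_lt_trans (ltry S); apply: ge_ereal_sup => _ [n /= n0n <-].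
rewrite ME; have [_] := stab (c n) (d n) (leq_trans n0n (dn n)); exact.
Qed.

Lemma FSM_simpleN_periodic (p : \bar R) (v : nat -> C) K :
  (1 <= p)%E -> K_periodicN K v -> dirichlet_unimodular v K ->
  FSM_simpleN p (schrodingerN v).
Proof.
case: K => [|k] p1 [// _ vK] uni.
apply: (FSM_simple_of_sections (b := (5 * k.+1)%N) (v := v) (k := k)
  (c := fun=> 0%N)) => //.
- by move=> lam; exact: approximate_kernelN.
- by move=> n; exact: finite_sectionN_jacobi.
Qed.

Lemma FSM_simpleZ_periodic (p : \bar R) (v : int -> C) K :
  (1 <= p)%E -> K_periodicZ K v -> dirichlet_unimodular (fun n => v n%:Z) K ->
  FSM_simpleZ p (schrodingerZ v).
Proof.
case: K => [|k] p1 [// _ vK] uni.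
have vK' (j : nat) : v (j + k.+1)%N = v j by rewrite PoszD vK.
apply: (FSM_simple_of_sections (b := (5 * k.+1)%N) (v := fun n => v n%:Z) (k := k)
  (c := fun n => (k * n)%N)) => //.
- by move=> lam; exact: approximate_kernelZ.
- by move=> n; exact: finite_sectionZ_jacobi.
- by move=> n; lia.
Qed.

End Criterion.

(** * Continuants of words over 0 and a rational number *)

(** The pair of determinants of the section described by [w] and by [w]
    without its first letter, where the letter [true] stands for [x]; [y] is
    the product of the two off-diagonal entries.  Taking [y = b ^ 2] and
    [x = a] clears the denominators when the value of the potential is
    [a / b]. *)
Fixpoint word_continuant (F : comNzRingType) (x y : F) (w : seq bool) : F * F :=
  if w is c :: w' then
    let: (p, q) := word_continuant x y w' in ((if c then x * p else 0) - y * q, p)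
  else (1, 0).

Fixpoint psub (P Q : seq BinNums.Z) : seq BinNums.Z :=
  match P, Q with
  | [::], _ => [seq - c | c <- Q]
  | _, [::] => P
  | c :: P', d :: Q' => (c - d) :: psub P' Q'
  end.

(** The same pair as polynomials in the unknown value of the potential,
    given by their lists of integer coefficients. *)
Fixpoint poly_continuant (w : seq bool) : seq BinNums.Z * seq BinNums.Z :=
  if w is c :: w' then
    let: (p, q) := poly_continuant w' in (psub (if c then 0 :: p else [::]) q, p)
  else ([:: 1], [::]).

Definition root_check (w : seq bool) (a b : BinNums.Z) : bool :=
  let: (p, q) := word_continuant a (b * b) w in
  (p == 0) ==> ((b * q) ^+ 2 == (b ^+ size w) ^+ 2).

(** If the polynomial of [w] is nonzero, every fraction allowed by the
    rational root theorem (numerator bounded by the lowest nonzero coefficient,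
    denumerator by the leading one) must pass [root_check].  If it vanishes
    identically, the polynomial of the shortened word must be 1 or -1. *)
Definition word_check (w : seq bool) : bool :=
  let: (P, Q) := poly_continuant w in
  if [seq c <- P | c != 0] is c :: nz then
    all (fun b => all (fun a => root_check w (BinInt.Z.of_nat a) (BinInt.Z.of_nat b)
                             && root_check w (- BinInt.Z.of_nat a) (BinInt.Z.of_nat b))
                      (iota 0 (BinInt.Z.abs_nat c).+1))
        (iota 1 (BinInt.Z.abs_nat (last c nz)))
  else (head 0 Q ^+ 2 == 1) && all (pred1 0) (behead Q).

Fixpoint words (n : nat) : seq (seq bool) :=
  if n is n'.+1 then map (cons true) (words n') ++ map (cons false) (words n')
  else [:: [::]].

Lemma mem_words w : w \in words (size w).
Proof.
elim: w => // c w IH /=; rewrite mem_cat; case: c; rewrite map_f ?orbT //.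
Qed.

Lemma word_check_upto7 : all (fun n => all word_check (words n)) (iota 0 8).
Proof. by vm_compute. Qed.

Definition ratZ (z : BinNums.Z) : rat := (int_of_Z z)%:~R.

Lemma ratZ0 : ratZ 0 = 0. Proof. by []. Qed.
Lemma ratZ1 : ratZ 1 = 1. Proof. by []. Qed.
Lemma ratZM : {morph ratZ : x y / x * y}.
Proof. by move=> x y; rewrite /ratZ !rmorphM. Qed.
Lemma ratZB : {morph ratZ : x y / x - y}.
Proof. by move=> x y; rewrite /ratZ !rmorphB. Qed.
Lemma ratZN : {morph ratZ : x / - x}.
Proof. by move=> x; rewrite /ratZ !rmorphN. Qed.
Lemma ratZX n : {morph ratZ : x / x ^+ n}.
Proof. by move=> x; rewrite /ratZ !rmorphXn. Qed.
Lemma ratZ_eq0 z : (ratZ z == 0) = (z == 0).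
Proof.
rewrite /ratZ intr_eq0 -(inj_eq (can_inj int_of_ZK)).
by rewrite -(rmorph0 int_of_Z).
Qed.

Definition peval (x : rat) (P : seq BinNums.Z) : rat := foldr (fun c e => ratZ c + x * e) 0 P.

Lemma peval_psub x P Q : peval x (psub P Q) = peval x P - peval x Q.
Proof.
elim: P Q => [|c P IH] [|d Q] //=; rewrite ?subr0 ?sub0r //.
  elim: Q d => [|e Q IHQ] d; first by rewrite /= mulr0 !addr0 ratZN.
  by rewrite /= in IHQ *; rewrite IHQ ratZN; ring.
by rewrite IH ratZB; ring.
Qed.

Lemma peval_poly_continuant x w :
  (peval x (poly_continuant w).1, peval x (poly_continuant w).2) = word_continuant x 1 w.
Proof.
elim: w => [|c w /=]; first by rewrite /= ratZ1 mulr0 addr0.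
case: (poly_continuant w) (word_continuant _ _ w) => [P Q] [p q] /= [<- <-].
by rewrite peval_psub mul1r; case: c; rewrite /= ?ratZ0 ?add0r.
Qed.

Section RationalRoot.
Variable x : rat.
Let a := numq x.
Let b := denq x.
Let bn0 : (b%:~R : rat) != 0. Proof. by rewrite intr_eq0 denq_neq0. Qed.
Let xb : x * b%:~R = a%:~R. Proof. by rewrite -{1}(divq_num_den x) mulfVK. Qed.
Let cab : coprimez a b. Proof. exact: coprime_num_den. Qed.

(** A polynomial listed with [n] coefficients has degree less than [n], so
    clearing its denominators with [b ^ n] leaves a spare factor [b]. *)
Lemma peval_denominator P : exists e : int,
  peval x P * b%:~R ^+ size P = (b * e)%:~R.
Proof.
elim: P => [|c P [e He]]; first by exists 0; rewrite /= mul0r mulr0.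
exists (int_of_Z c * b ^+ size P + a * e).
rewrite /= !(rmorphM, rmorphD, rmorphXn) /= -/(ratZ c) in He *.
rewrite exprS mulrDl -mulrA.
have -> : x * (peval x P * (b%:~R * b%:~R ^+ size P)) =
   (x * b%:~R) * (peval x P * b%:~R ^+ size P) by ring.
by rewrite He xb; ring.
Qed.

Lemma root_low P c s : peval x P = 0 -> [seq c <- P | c != 0] = c :: s ->
  (`|a| <= `|int_of_Z c|)%N.
Proof.
elim: P => //= d P IH; have [->|d0] := eqVneq d 0.
  rewrite ratZ0 add0r => /eqP; rewrite mulf_eq0 => /orP[/eqP x0 _|/eqP P0 cs].
    by rewrite /a x0.
  exact: IH.
move=> dP [<- _]; have [e He] := peval_denominator P.
have : (int_of_Z d * b ^+ (size P).+1)%:~R + (a * (b * e))%:~R = 0 :> rat.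
  have -> : (a * (b * e))%:~R = x * b%:~R * (peval x P * b%:~R ^+ size P) :> rat.
    by rewrite He xb intrM.
  rewrite rmorphM rmorphXn /= exprS -/(ratZ d).
  have -> : ratZ d * (b%:~R * b%:~R ^+ size P) + x * b%:~R * (peval x P * b%:~R ^+ size P)
    = (ratZ d + x * peval x P) * (b%:~R * b%:~R ^+ size P) by ring.
  by rewrite dP mul0r.
rewrite -rmorphD /= => /eqP; rewrite intr_eq0 addr_eq0 => /eqP E.
have : (a %| int_of_Z d * b ^+ (size P).+1)%Z by rewrite E dvdzE abszN -dvdzE dvdz_mulr.
rewrite Gauss_dvdzl; last by rewrite coprimezXr.
by move=> /dvdn_leq; apply; rewrite absz_gt0 -(intr_eq0 rat) -/(ratZ d) ratZ_eq0.
Qed.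

Lemma root_lead P c s : peval x P = 0 -> [seq c <- P | c != 0] = c :: s ->
  (`|b| <= `|int_of_Z (last c s)|)%N.
Proof.
have -> : last c s = last 0 (c :: s) by [].
move=> + E; rewrite -E => P0; have {E} : [seq c <- P | c != 0] != [::] by rewrite E.
have peval_rcons Q d : peval x (rcons Q d) = peval x Q + x ^+ size Q * ratZ d.
  elim: Q => [|f Q IH] /=; first by rewrite expr0; ring.
  by rewrite IH exprS; ring.
elim/last_ind: P P0 => //= P d IH; rewrite peval_rcons filter_rcons.
have [->|d0] := eqVneq d 0; first by rewrite ratZ0 mulr0 addr0.
move=> Pd _; rewrite last_rcons; have [e He] := peval_denominator P.
have : (b * e)%:~R + (a ^+ size P * int_of_Z d)%:~R = 0 :> rat.
  rewrite -He rmorphM rmorphXn /= -xb exprMn -/(ratZ d).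
  have -> : peval x P * b%:~R ^+ size P + x ^+ size P * b%:~R ^+ size P * ratZ d
    = (peval x P + x ^+ size P * ratZ d) * b%:~R ^+ size P by ring.
  by rewrite Pd mul0r.
rewrite -rmorphD /= => /eqP; rewrite intr_eq0 addrC addr_eq0 => /eqP E.
have : (b %| a ^+ size P * int_of_Z d)%Z by rewrite E dvdzE abszN -dvdzE dvdz_mulr.
rewrite Gauss_dvdzr; last by rewrite coprimezXr // coprimez_sym.
by move=> /dvdn_leq; apply; rewrite absz_gt0 -(intr_eq0 rat) -/(ratZ d) ratZ_eq0.
Qed.

(** [root_check] is homogeneous: it tests the scaled values
    [b ^ n * p] and [b ^ n * q], with [n] the length of the word. *)
Lemma root_checkP w (A B : BinNums.Z) : int_of_Z A = a -> int_of_Z B = b ->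
  root_check w A B -> (word_continuant x 1 w).1 = 0 -> (word_continuant x 1 w).2 ^+ 2 = 1.
Proof.
move=> Aa Bb.
have hom : ratZ (word_continuant A (B * B) w).1
      = ratZ B ^+ size w * (word_continuant x 1 w).1 /\
    ratZ B * ratZ (word_continuant A (B * B) w).2
      = ratZ B ^+ size w * (word_continuant x 1 w).2.
  have AE : ratZ A = ratZ B * x by rewrite /ratZ Aa Bb mulrC xb.
  elim: w => [|c w] /=; first by rewrite ratZ0 ratZ1 !mulr0 mul1r.
  case: (word_continuant A _ w) (word_continuant x 1 w) => [P Q] [p q] /= [EP EQ].
  rewrite EP exprS mulrA; split=> //.
  rewrite ratZB !ratZM -[in X in _ - X = _]mulrA EQ.
  by case: c; rewrite ?ratZM ?ratZ0 ?EP ?AE; ring.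
rewrite /root_check; case: (word_continuant A _ w) hom => [P Q] /= [EP EQ].
move=> /implyP H p0; have P0 : P = 0 by apply/eqP; rewrite -ratZ_eq0 EP p0 mulr0.
have /eqP/(congr1 ratZ) := H (introT eqP P0).
rewrite !ratZX ratZM EQ exprMn => E.
have Bn0 : (ratZ B ^+ size w) ^+ 2 != 0 by rewrite !expf_eq0 /= andbC /ratZ Bb (negPf bn0).
by apply: (mulfI Bn0); rewrite E mulr1.
Qed.

Lemma short_word_root w : (size w <= 7)%N ->
  (word_continuant x 1 w).1 = 0 -> (word_continuant x 1 w).2 ^+ 2 = 1.
Proof.
move=> w7 w0; have : word_check w.
  have /allP/(_ (size w)) := word_check_upto7.
  by rewrite mem_iota ltnS => /(_ w7)/allP; apply; exact: mem_words.
rewrite /word_check; have := peval_poly_continuant x w.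
case: (poly_continuant w) => [P Q] E; have P0 : peval x P = 0 by rewrite -w0 -E.
case defP: [seq c <- P | c != 0] => [|c nz].
  case/andP=> /eqP Q1 /allP Q0; rewrite -E /=.
  have -> : peval x Q = ratZ (head 0 Q).
    case: Q {E Q1} Q0 => [|d Q] //= Q0.
    suff -> : peval x Q = 0 by rewrite mulr0 addr0.
    elim: Q Q0 => //= f Q IH Q0; rewrite IH => [|g gQ]; last by rewrite Q0 // inE gQ orbT.
    by have /eqP -> := Q0 f (mem_head _ _); rewrite ratZ0 mulr0 addr0.
  by rewrite -ratZX Q1.
have aL := root_low P0 defP; have bL := root_lead P0 defP.
have absE z : BinInt.Z.abs_nat z = `|int_of_Z z|%N by lia.
move=> /allP/(_ `|b|%N); rewrite mem_iota add1n ltnS absE bL absz_gt0 denq_neq0.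
move=> /(_ isT)/allP/(_ `|a|%N); rewrite mem_iota add0n ltnS absE aL.
move=> /(_ isT)/andP[C1 C2].
have Bb : int_of_Z (BinInt.Z.of_nat `|b|%N) = b by have := denq_gt0 x; rewrite -/b; lia.
have [a0|a0] := leP 0 a.
  by apply: root_checkP Bb C1 w0; lia.
by apply: root_checkP Bb C2 w0; lia.
Qed.
End RationalRoot.

(** * The three classes of potentials *)

Section Words.
Opaque dirichlet.

(** Moves the arithmetic of the potential to the integers or rationals. *)
Lemma rmorph_dirichlet (F G : comNzRingType) (f : {rmorphism F -> G}) (w : nat -> F) a n :
  dirichlet (fun j => f (w j)) a n = f (dirichlet w a n).
Proof.
elim/ltn_ind: n => -[_|[_|n IH]]; rewrite ?rmorph0 ?rmorph1 //.
by rewrite !dirichletSS !IH // rmorphB rmorphM.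
Qed.

(** Here determinant one makes [dirichlet w a k.+2] a divisor of [-1]. *)
Lemma int_unimodular (w : nat -> int) k a :
  dirichlet w a k.+1 = 0 -> dirichlet w a k.+2 ^+ 2 = 1.
Proof.
move=> Da; have := dirichlet_wronskian w a k; rewrite Da mul0r subr0.
move/(congr1 absz)/eqP; rewrite abszM abszN muln_eq1 => /andP[/eqP x1 _].
by rewrite -[LHS]gez0_abs ?sqr_ge0 // abszX x1.
Qed.

Lemma word_continuant_dirichlet (F : comNzRingType) (w : nat -> F) x :
  (forall j, w j = 0 \/ w j = x) -> forall n a,
  word_continuant x 1 [seq w j == x | j <- iota a n]
  = (dirichlet w a n.+1, dirichlet w a.+1 n).
Proof.
move=> w0x; elim=> [//|n IH] a; rewrite /= IH mul1r dirichlet_lrec; congr (_ - _, _).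
by case: eqP => [->//|wx]; case: (w0x a) => [->|/wx//]; rewrite mul0r.
Qed.

(** By determinant one it is enough that the section without its first site
    has determinant 1 or -1, and the word of that section is one letter
    shorter. *)
Lemma two_valued_unimodular (w : nat -> rat) x k a : (k < 8)%N ->
  (forall j, w j = 0 \/ w j = x) ->
  dirichlet w a k.+1 = 0 -> dirichlet w a k.+2 ^+ 2 = 1.
Proof.
move=> k8 w0x Da; have := dirichlet_wronskian w a k; rewrite Da mul0r subr0 => W.
have E := word_continuant_dirichlet w0x k a.
have := @short_word_root x [seq w j == x | j <- iota a k].
rewrite size_map size_iota E /= => /(_ k8 Da) y2.
by rewrite -[LHS]mulr1 -y2 -exprMn W sqrrN expr1n.
Qed.

End Words.

Section Potentials.
Context {R : realType}.
Local Notation C := R[i].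
Implicit Types v : nat -> C.

Lemma integer_unimodular v K : (0 < K)%N -> integer_valued v -> dirichlet_unimodular v K.
Proof.
case: K => // k _ /choice[w vw] a.
have -> : v = fun j => intr (w j) by apply/funext.
rewrite !rmorph_dirichlet => /eqP; rewrite intr_eq0 => /eqP /int_unimodular.
by rewrite -rmorphXn /= => ->.
Qed.

Lemma two_rational_unimodular v K (lambda : rat) : (0 < K < 9)%N ->
  (forall j, v j = 0 \/ v j = ratr lambda) -> dirichlet_unimodular v K.
Proof.
case: K => // k; rewrite /= ltnS => k8 v0l a.
pose w j := if v j == 0 then 0 else lambda.
have -> : v = fun j => ratr (w j).
  apply/funext => j; rewrite /w; case: eqP => [->|v0]; first by rewrite rmorph0.
  by case: (v0l j).
rewrite !rmorph_dirichlet => /eqP; rewrite fmorph_eq0 => /eqP Da.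
rewrite -rmorphXn /= (two_valued_unimodular k8 _ Da (x := lambda)) ?rmorph1 // => j.
by rewrite /w; case: ifP; [left | right].
Qed.

Lemma period2_unimodular v : dirichlet_unimodular v 2.
Proof.
move=> a; rewrite (dirichletSS v a 1) => D2; rewrite D2.
by rewrite mulr0 sub0r sqrrN expr1n.
Qed.
End Potentials.

Theorem theorem1p1 (R : realType) (p : \bar R) (hp : (1 <= p)%E) :
  (forall v : int -> R[i], (exists K : nat, K_periodicZ K v) ->
     [/\ integer_valued v -> FSM_simpleZ p (schrodingerZ v),
         forall lambda : rat,
           (exists K : nat, (K < 9)%N /\ K_periodicZ K v) ->
           (forall k, v k = 0 \/ v k = ratr lambda) ->
           FSM_simpleZ p (schrodingerZ v)
       & K_periodicZ 2 v -> real_valued v -> FSM_simpleZ p (schrodingerZ v)])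
  /\
  (forall v : nat -> R[i], (exists K : nat, K_periodicN K v) ->
     [/\ integer_valued v -> FSM_simpleN p (schrodingerN v),
         forall lambda : rat,
           (exists K : nat, (K < 9)%N /\ K_periodicN K v) ->
           (forall k, v k = 0 \/ v k = ratr lambda) ->
           FSM_simpleN p (schrodingerN v)
       & K_periodicN 2 v -> real_valued v -> FSM_simpleN p (schrodingerN v)]).
Proof.
split=> v [K vK]; split.
- move=> vint; apply: (FSM_simpleZ_periodic hp vK).
  by apply: integer_unimodular => [|j]; [case: vK | exact: vint].
- move=> lambda [L [L9 vL]] v0l; apply: (FSM_simpleZ_periodic hp vL).
  apply: (two_rational_unimodular (lambda := lambda)) => [|j]; last exact: v0l.
  by rewrite L9 andbT; case: vL.
- by move=> v2 _; apply: (FSM_simpleZ_periodic hp v2); exact: period2_unimodular.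
- move=> vint; apply: (FSM_simpleN_periodic hp vK).
  by apply: integer_unimodular => [|j]; [case: vK | exact: vint].
- move=> lambda [L [L9 vL]] v0l; apply: (FSM_simpleN_periodic hp vL).
  apply: (two_rational_unimodular (lambda := lambda)) => [|j]; last exact: v0l.
  by rewrite L9 andbT; case: vL.
- by move=> v2 _; apply: (FSM_simpleN_periodic hp v2); exact: period2_unimodular.
Qed.
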